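(* Let $p\ge 2$ and consider the problem of minimizing $f(x)$ over $x\in\mathbb{R}^n$ subject to $a_i^Tx-b_i=0$ for $i=1,\ldots,m$, where $f:\mathbb{R}^n\to\mathbb{R}$ is $p$-times differentiable, $a_i\in\mathbb{R}^n$ and $b_i\in\mathbb{R}$. Suppose that Algorithm 1 is applied to this problem with $f$ satisfying assumptions A1 and A5. Moreover, assume that at each outer iteration $k$ of Algorithm 1 a monotone method $\mathcal{M}_p$ satisfying A6 is used to approximately minimize $P(\cdot,\lambda^{(k)},\sigma^{(k)})$ (as required in Step 1), with starting point $$\tilde{x}_{k,0}=\arg\min\{P(y,\lambda^{(k)},\sigma^{(k)}) : y\in\{x_0,x_k\}\}.$$ Then the following statements are true: (a) If $\{\sigma^{(k)}\}_{k\ge 0}$ is bounded from above by $\sigma_{max}$, then Algorithm 1 takes at most $\mathcal{O}\left(|\log(\epsilon)|^2\epsilon^{-\frac{p+1}{p}}\right)$ inner iterations of $\mathcal{M}_p$ to generate an $\epsilon$-approximate KKT point of the problem. (b) If $\lim_{k\to+\infty}\sigma^{(k)}=+\infty$, then Algorithm 1 takes at most $\mathcal{O}\left(\epsilon^{-\left(\frac{4}{\alpha-1}+\frac{p+1}{p}\right)}\right)$ inner iterations of $\mathcal{M}_p$ to generate an $\epsilon$-approximate KKT point of the problem.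
   Context: Notation: $c_i(x)=a_i^Tx-b_i$ and $c(x)=(c_1(x),\ldots,c_m(x))$. A point satisfying all the constraints is called feasible. $D^pf(x)$ denotes the $p$-th order derivative of $f$ at $x$, the tensor with entries $\partial^pf/\partial x_{i_1}\cdots\partial x_{i_p}(x)$. Assumption A1: $f$ is continuously differentiable, bounded below by $f_{low}$, and for every $u\in\mathbb{R}$ the set $\{x\in\mathbb{R}^n: f(x)\le u\}$ is bounded. Assumption A5: $D^pf$ is $L_p$-Lipschitz continuous, i.e. $\|D^pf(x)-D^pf(y)\|\le L_p\|x-y\|$ for all $x,y\in\mathbb{R}^n$ (Euclidean norm on vectors and the induced norm on tensors). Assumption A6 on $\mathcal{M}_p$: given any $p$-times differentiable $g:\mathbb{R}^n\to\mathbb{R}$ bounded below by $g_{low}$ with $L$-Lipschitz continuous $p$-th order derivative, the method $\mathcal{M}_p$ with starting point $\tilde{x}$ can find an $\epsilon$-approximate stationary point of $g$ (a point where $\|\nabla g\|_2\le\epsilon$) in at most $C_{\mathcal{M}_p}L^{1/p}(g(\tilde{x})-g_{low})\epsilon^{-\frac{p+1}{p}}$ iterations, where $C_{\mathcal{M}_p}>0$ depends only on the method. Monotone means that the objective values along the iterates of $\mathcal{M}_p$ are nonincreasing. The iterates of $\mathcal{M}_p$ are called inner iterations; $x_{k+1}$ is the first iterate produced by $\mathcal{M}_p$ that satisfies the requirements of Step 1 below. Augmented Lagrangian: $P(x,\lambda,\sigma)=f(x)+\sum_{i=1}^{m}[-\lambda_ic_i(x)+\frac12\sigma c_i(x)^2]$.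 Lagrangian: $L(x,\lambda)=f(x)-\sum_{i=1}^m\lambda_ic_i(x)$. Algorithm 1 (Augmented Lagrangian Method, for equality constraints only). Step 0: given a feasible point $x_0\in\mathbb{R}^n$, $\lambda^{(0)}\in\mathbb{R}^m$, $\alpha>1$, $\sigma^{(0)}>0$ and $\gamma,\epsilon\in(0,1)$, set $k:=0$. Step 1: find $x_{k+1}$ such that $P(x_{k+1},\lambda^{(k)},\sigma^{(k)})\le\min\{P(x_k,\lambda^{(k)},\sigma^{(k)}),P(x_0,\lambda^{(k)},\sigma^{(k)})\}$ and $\|\nabla_xP(x_{k+1},\lambda^{(k)},\sigma^{(k)})\|_\infty\le\epsilon$. Step 2: compute $$\theta^{(k+1)}=\max\left\{\left\|\frac{\lambda^{(k)}}{\sigma^{(k)}}\right\|_\infty,\left\|c(x_{k+1})-\frac{\lambda^{(k)}}{\sigma^{(k)}}\right\|_\infty\right\}.$$ If $k=0$, set $\sigma^{(k+1)}=\sigma^{(k)}$; otherwise set $\sigma^{(k+1)}=\sigma^{(k)}$ if $\theta^{(k+1)}\le\gamma\theta^{(k)}$, and $\sigma^{(k+1)}=\max\{(k+1)^\alpha,\sigma^{(k)}\}$ otherwise. Step 3: set $\lambda_i^{(k+1)}=\lambda_i^{(k)}-\sigma^{(k)}c_i(x_{k+1})$ for $i=1,\ldots,m$. Step 4: set $k:=k+1$ and return to Step 1. $\epsilon$-approximate KKT point: a generated pair $(x_k,\lambda^{(k)})$ with $\|\nabla_xL(x_k,\lambda^{(k)})\|_\infty\le\epsilon$ and $\|c(x_k)\|_\infty\le\epsilon$.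 Here $\epsilon\in(0,1)$ is the tolerance used in Algorithm 1. Convention on $\mathcal{O}$: bounds are for the total number of inner iterations, as $\epsilon\to 0^+$; the implied constants do not depend on $\epsilon$ but may depend on $C_{\mathcal{M}_p}$, $p$, the problem data ($n$, $a_i$, $b_i$, $L_p$, $f(x_0)-f_{low}$), $\lambda^{(0)}$, $\sigma^{(0)}$, $\alpha$, $\gamma$, and (in (a)) on the $\epsilon$-independent bound $\sigma_{max}$. *)

(* Defs.v *)
From HB Require Import structures.
From mathcomp Require Import all_boot all_order all_algebra.
From mathcomp Require Import all_classical all_reals all_analysis.
Set Implicit Arguments.
Unset Strict Implicit.
Unset Printing Implicit Defensive.
Import Order.TTheory GRing.Theory Num.Theory.
Import numFieldNormedType.Exports.
Local Open Scope classical_set_scope.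
Local Open Scope ring_scope.

(* Points of R^n are row vectors.  The library norm `|x| on 'rV[R]_n is the
   sup norm; the Euclidean norm is [enorm]. *)
Definition dotv (R : realType) (n : nat) (u v : 'rV[R]_n) : R :=
  \sum_(i < n) u 0 i * v 0 i.

Definition enorm (R : realType) (n : nat) (u : 'rV[R]_n) : R :=
  Num.sqrt (dotv u u).

Definition partial (R : realType) (n : nat) (i : 'I_n) (g : 'rV[R]_n -> R) :
  'rV[R]_n -> R := fun x => 'D_(delta_mx 0 i) g x.

Definition grad (R : realType) (n : nat) (g : 'rV[R]_n -> R) (x : 'rV[R]_n) :
  'rV[R]_n := \row_(i < n) partial i g x.

(* p-fold Frechet differentiability on the whole space: g is differentiable
   and all components of its derivative are (p-1)-times differentiable. *)
Fixpoint times_differentiable (R : realType) (n p : nat)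
    (g : 'rV[R]_n -> R) : Prop :=
  if p is p'.+1 then
    (forall x, differentiable g x) /\
    (forall i : 'I_n, times_differentiable p' (partial i g))
  else True.


Definition deriv_tensor (R : realType) (n p : nat) (g : 'rV[R]_n -> R)
    (x : 'rV[R]_n) : {ffun p.-tuple 'I_n -> R} :=
  [ffun s : p.-tuple 'I_n => foldr (@partial R n) g s x].

Definition tensor_apply (R : realType) (n p : nat)
    (T : {ffun p.-tuple 'I_n -> R}) (u : 'I_p -> 'rV[R]_n) : R :=
  \sum_(s : p.-tuple 'I_n) T s * \prod_(j < p) u j 0 (tnth s j).

(* Norm induced by the Euclidean norm.  The supremum is over products of unit
   balls rather than unit spheres, which are empty when n = 0. *)
Definition tensor_norm (R : realType) (n p : nat)
    (T : {ffun p.-tuple 'I_n -> R}) : R :=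
  sup [set `|tensor_apply T u| | u in
         [set u : 'I_p -> 'rV[R]_n | forall j, enorm (u j) <= 1]].

Definition lipschitz_deriv (R : realType) (n p : nat) (g : 'rV[R]_n -> R)
    (L : R) : Prop :=
  forall x y, tensor_norm (deriv_tensor p g x - deriv_tensor p g y)
              <= L * enorm (x - y).

Definition bounded_below (R : realType) (n : nat) (g : 'rV[R]_n -> R)
    (glow : R) : Prop := forall x, glow <= g x.

Definition assumptionA1 (R : realType) (n : nat) (f : 'rV[R]_n -> R)
    (flow : R) : Prop :=
  [/\ forall x, differentiable f x,
      continuous (grad f),
      bounded_below f flow
    & forall u : R, bounded_set [set x | f x <= u]].

(* An unconstrained minimization method on R^n: [iterates M g e y j] is the
   j-th iterate of M run on the objective g from the starting point y with
   target accuracy e. *)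
Record method (R : realType) (n : nat) := Method {
  iterates : ('rV[R]_n -> R) -> R -> 'rV[R]_n -> nat -> 'rV[R]_n;
  iterates0 : forall g e y, iterates g e y 0%N = y
}.

(* The objectives to which the complexity guarantee applies. *)
Definition smooth_objective (R : realType) (n p : nat) (g : 'rV[R]_n -> R)
    (glow L : R) : Prop :=
  [/\ times_differentiable p g, bounded_below g glow
    & lipschitz_deriv p g L].

(* A number of iterations being an integer, the real bound is rounded up: for
   g a convex quadratic and p >= 2, every L > 0 is admissible, so the bound can
   be made smaller than 1, and without rounding every starting point would have
   to be approximately stationary.  L = 0 (bound 0) is excluded likewise. *)
Definition assumptionA6 (R : realType) (n p : nat) (M : method R n) (C : R) :
    Prop :=
  forall (g : 'rV[R]_n -> R) (glow L e : R) (y : 'rV[R]_n),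
    smooth_objective p g glow L -> 0 < L -> 0 < e ->
    exists j : nat,
      (j%:Z <= Num.ceil (C * L `^ (p%:R^-1) * (g y - glow)
                           * e `^ (- (p.+1%:R / p%:R)))) /\
      enorm (grad g (iterates M g e y j)) <= e.

Definition monotone_method (R : realType) (n p : nat) (M : method R n) : Prop :=
  forall (g : 'rV[R]_n -> R) (glow L e : R) (y : 'rV[R]_n),
    smooth_objective p g glow L -> 0 < L -> 0 < e ->
    forall j : nat, g (iterates M g e y j.+1) <= g (iterates M g e y j).

Section Problem.
Variables (R : realType) (n m : nat).
Variables (f : 'rV[R]_n -> R) (a : 'I_m -> 'rV[R]_n) (b : 'I_m -> R).

Definition constr (x : 'rV[R]_n) : 'rV[R]_m := \row_(i < m) (dotv (a i) x - b i).

Definition feasible (x : 'rV[R]_n) : Prop := forall i, dotv (a i) x - b i = 0.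

Definition lagrangian (lam : 'rV[R]_m) (x : 'rV[R]_n) : R :=
  f x - \sum_(i < m) lam 0 i * constr x 0 i.

Definition auglag (lam : 'rV[R]_m) (sig : R) (x : 'rV[R]_n) : R :=
  f x + \sum_(i < m) (- (lam 0 i * constr x 0 i)
                      + 2^-1 * sig * constr x 0 i ^+ 2).

Definition approx_KKT (eps : R) (x : 'rV[R]_n) (lam : 'rV[R]_m) : Prop :=
  `|grad (lagrangian lam) x| <= eps /\ `|constr x| <= eps.

(* Requirements of Step 1 on a candidate y for x_{k+1}. *)
Definition step1 (eps : R) (x0 xk : 'rV[R]_n) (lam : 'rV[R]_m) (sig : R)
    (y : 'rV[R]_n) : Prop :=
  auglag lam sig y <= Num.min (auglag lam sig xk) (auglag lam sig x0) /\
  `|grad (auglag lam sig) y| <= eps.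

(* Sequences generated by the algorithm.  [start k] is the starting point of
   the method at outer iteration k and [inner k] the number of inner
   iterations it performs to produce x_{k+1}; [theta 0] is never used. *)
Record trace := Trace {
  xs : nat -> 'rV[R]_n;
  lambda : nat -> 'rV[R]_m;
  sigma : nat -> R;
  theta : nat -> R;
  start : nat -> 'rV[R]_n;
  inner : nat -> nat
}.

Record alm_run (M : method R n) (x0 : 'rV[R]_n) (lambda0 : 'rV[R]_m)
    (alpha sigma0 gamma eps : R) (t : trace) : Prop := AlmRun {
  run_params : [/\ 1 < alpha, 0 < sigma0, 0 < gamma < 1 & 0 < eps < 1];
  run_feasible : feasible x0;
  run_x0 : xs t 0%N = x0;
  run_lambda0 : lambda t 0%N = lambda0;
  run_sigma0 : sigma t 0%N = sigma0;
  (* a minimizer over {x_0, x_k}; either one in case of a tie *)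
  run_start : forall k,
    let P := auglag (lambda t k) (sigma t k) in
    [/\ start t k = x0 \/ start t k = xs t k,
        P (start t k) <= P x0 & P (start t k) <= P (xs t k)];
  run_step1 : forall k,
    let P := auglag (lambda t k) (sigma t k) in
    let z := iterates M P eps (start t k) in
    let ok := step1 eps x0 (xs t k) (lambda t k) (sigma t k) in
    [/\ xs t k.+1 = z (inner t k), ok (z (inner t k))
      & forall j, (j < inner t k)%N -> ~ ok (z j)];
  run_theta : forall k,
    theta t k.+1 =
      Num.max `|(sigma t k)^-1 *: lambda t k|
              `|constr (xs t k.+1) - (sigma t k)^-1 *: lambda t k|;
  run_sigma : forall k,
    sigma t k.+1 =
      if (k == 0%N) || (theta t k.+1 <= gamma * theta t k) then sigma t k
      else Num.max (k.+1%:R `^ alpha) (sigma t k);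
  run_lambda : forall k,
    lambda t k.+1 = lambda t k - sigma t k *: constr (xs t k.+1)
}.

(* Some outer iteration generates an eps-approximate KKT pair, the total number
   of inner iterations performed up to and including it being at most B. *)
Definition KKT_within (eps : R) (t : trace) (B : R) : Prop :=
  exists k : nat,
    approx_KKT eps (xs t k.+1) (lambda t k.+1) /\
    (\sum_(i < k.+1) inner t i)%N%:R <= B.

End Problem.

(* Main.v *)
(* Completing the square, P(x, lam, s) = f(x) + |lam - s c(x)|^2 / (2 s)
   - |lam|^2 / (2 s), where lam - s c(x) is the updated multiplier.  As x_{k+1}
   does no worse than the feasible point x_0, this gives by induction
   |lam_k|^2 <= sigma_k (A + 2 Delta k) with A = |lam_0|^2 / sigma_0, whence
   theta_{k+1}^2 <= (A + 2 Delta (k+1)) / sigma_k, while the k-th call of the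
   method costs O((k + 1) eps^(-(p+1)/p)) because the penalty, being quadratic,
   does not change the Lipschitz constant of the p-th derivative (p >= 2).
   The gradient condition of an approximate KKT pair always holds, and
   |c(x_{k+1})| <= 2 theta_{k+1}; so if theta <= eps/2 occurs within N outer
   iterations the total cost is O(N^2 eps^(-(p+1)/p)).
   Each iteration either contracts theta by gamma or brings sigma above
   (k+1)^alpha.  If sigma is bounded the second case stops occurring after
   finitely many steps, so N = O(|log eps|).  In general, on a window
   [T, 2T) either some sigma exceeds T^alpha or theta contracts T times; both
   give theta^2 = O(T^(1-alpha)), hence N = O(eps^(-2/(alpha-1))). *)
Require Import Defs.
From HB Require Import structures.
From mathcomp Require Import all_boot all_order all_algebra.
From mathcomp Require Import all_classical all_reals all_analysis.
From mathcomp Require Import ring lra.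
Set Implicit Arguments.
Unset Strict Implicit.
Unset Printing Implicit Defensive.
Import Order.TTheory GRing.Theory Num.Theory.
Import numFieldNormedType.Exports.
Local Open Scope classical_set_scope.
Local Open Scope ring_scope.

(** * Derivatives of functions of row vectors and comparison of the two norms *)

Section Calculus.
Variables (R : realType) (n : nat).
Implicit Types (g h : 'rV[R]_n -> R) (u v x y : 'rV[R]_n).

Lemma dotv_sumE u :
  dotv u = \sum_(i < n) (u 0 i \*: (fun x : 'rV[R]_n => x 0 i : R)).
Proof. by apply/funext => x; rewrite fct_sumE. Qed.

Lemma differentiable_dotv u x : differentiable (dotv u) x.
Proof.
rewrite dotv_sumE; apply: differentiable_sum => i.
exact/differentiableZ/differentiable_coord.
Qed.

Lemma dotv_is_linear u : linear (dotv u : 'rV[R]_n -> R^o).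
Proof.
move=> k x y; rewrite /dotv scaler_sumr -big_split /=; apply: eq_bigr => i _.
by rewrite !mxE mulrDr mulrCA.
Qed.

Lemma is_derive_dotv u x v : is_derive x v (dotv u) (dotv u v).
Proof.
pose fM := GRing.isLinear.Build _ _ _ _ _ (dotv_is_linear u).
pose f : {linear _ -> R^o} := HB.pack (dotv u : 'rV[R]_n -> R^o) fM.
apply: DeriveDef; first exact/diff_derivable/differentiable_dotv.
rewrite deriveE; last exact: differentiable_dotv.
have -> : dotv u = f by [].
rewrite diff_lin // => z.
exact/differentiable_continuous/(differentiable_dotv u).
Qed.

Lemma partialD i g h : (forall x, differentiable g x) ->
  (forall x, differentiable h x) ->
  partial i (g + h) = partial i g + partial i h.
Proof.
move=> dg dh; apply/funext => x.
by rewrite /partial deriveD //; exact: diff_derivable.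
Qed.

Lemma partial_cst i (c : R) : partial i (cst c) = cst 0 :> ('rV[R]_n -> R).
Proof. by apply/funext => x; rewrite /partial derive_val. Qed.

Lemma times_differentiable_cst p (c : R) :
  times_differentiable p (cst c : 'rV[R]_n -> R).
Proof.
elim: p c => [//|p IH] c; split=> [x|i]; first exact: differentiable_cst.
by rewrite partial_cst.
Qed.

Lemma times_differentiableD p g h : times_differentiable p g ->
  times_differentiable p h -> times_differentiable p (g + h).
Proof.
elim: p g h => [//|p IH] g h [dg pg] [dh ph]; split=> [x|i].
  exact: differentiableD.
by rewrite partialD //; apply: IH; [exact: pg|exact: ph].
Qed.

Lemma times_differentiableW p g :
  times_differentiable p.+1 g -> times_differentiable p g.
Proof.
elim: p g => [//|p IH] g [dg pg]; split=> // i; exact/IH/pg.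
Qed.

Lemma times_differentiable_foldr (s : seq 'I_n) p g :
  times_differentiable (size s + p) g ->
  times_differentiable p (foldr (@partial R n) g s).
Proof.
elim: s p => [//|i s IH] p; rewrite [size _]/= addSnnS => /IH.
by case=> _ tg; exact: tg.
Qed.

(** [c'] is [c] when [s] is empty and [0] otherwise; the existential spares a case distinction. *)
Lemma foldr_partialD_cst (s : seq 'I_n) g (c : R) :
  times_differentiable (size s) g -> exists c' : R,
  foldr (@partial R n) (g + cst c) s = foldr (@partial R n) g s + cst c'.
Proof.
elim: s c => [|i s IH] c; first by exists c.
rewrite [foldr _ _ _]/= [size _]/= => td; exists 0.
have [|c' ->] := IH c; first exact: times_differentiableW.
rewrite partialD; first by rewrite partial_cst.
  by move: td; rewrite -addn1 => /times_differentiable_foldr[].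
by move=> x; exact: differentiable_cst.
Qed.

(* Only second partial derivatives of the perturbation [h] need to be constant:
   this is where [2 <= p] enters. *)
Lemma deriv_tensorB_quadratic p g h x y : times_differentiable p.+2 g ->
  (forall z, differentiable h z) ->
  (forall i z, differentiable (partial i h) z) ->
  (forall i j, exists c, partial i (partial j h) = cst c) ->
  deriv_tensor p.+2 (g + h) x - deriv_tensor p.+2 (g + h) y =
  deriv_tensor p.+2 g x - deriv_tensor p.+2 g y.
Proof.
move=> [dg tg] dh dph ch; apply/ffunP => s; rewrite !ffunE.
suff [c ->] : exists c : R,
    foldr (@partial R n) (g + h) s = foldr (@partial R n) g s + cst c.
  rewrite !fctE /=; ring.
(* In [foldr] the last index acts first, so the last two indices are peeled off: they turn [h] into
   a constant. *)
case: s => s /= /eqP; case/lastP: s => [//|s j]; rewrite size_rcons => -[].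
case/lastP: s => [//|s i]; rewrite size_rcons => -[sz].
rewrite -!cats1 -catA !foldr_cat /= partialD //.
have [dgj tgj] := tg j.
rewrite partialD //; have [c ->] := ch i j.
by apply: foldr_partialD_cst; rewrite sz; exact: tgj.
Qed.

(** Passes from the Euclidean stationarity guaranteed by the method to the sup-norm test of Step
    1. *)
Lemma normv_le_enorm u : `|u| <= enorm u.
Proof.
rewrite [leLHS]/Num.norm /= mx_normrE; apply/bigmax_leP; split; first exact: sqrtr_ge0.
move=> [k i] _ /=; rewrite ord1 -sqrtr_sqr ler_wsqrtr // /dotv (bigD1 i) //=.
by rewrite -expr2 lerDl sumr_ge0 // => j _; rewrite -expr2 sqr_ge0.
Qed.

Lemma dotvv_ge0 u : 0 <= dotv u u.
Proof. by apply: sumr_ge0 => i _; rewrite -expr2 sqr_ge0. Qed.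

Lemma sqr_normv_le u : `|u| ^+ 2 <= dotv u u.
Proof.
rewrite -[leRHS]sqr_sqrtr ?dotvv_ge0 // lerXn2r ?nnegrE ?sqrtr_ge0 //.
exact: normv_le_enorm.
Qed.

End Calculus.

(** * The quadratic penalty and its derivatives *)

Section Penalty.
Variables (R : realType) (n m : nat) (a : 'I_m -> 'rV[R]_n) (b : 'I_m -> R).
Implicit Types (f : 'rV[R]_n -> R) (lam : 'rV[R]_m) (s : R) (x v : 'rV[R]_n).

(** The value [s = 0] covers the Lagrangian, so one derivative computation serves both functions. *)
Definition penalty lam s : 'rV[R]_n -> R := fun x =>
  \sum_(i < m) (- (lam 0 i * constr a b x 0 i)
                + 2^-1 * s * constr a b x 0 i ^+ 2).

Lemma auglagE f lam s : auglag f a b lam s = f + penalty lam s.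
Proof. by []. Qed.

Lemma lagrangianE f lam : lagrangian f a b lam = f + penalty lam 0.
Proof.
apply/funext => x; rewrite /lagrangian /penalty !fctE -sumrN; congr (_ + _).
by apply: eq_bigr => i _; rewrite mulr0 mul0r addr0.
Qed.

Lemma is_derive_constr i x v :
  is_derive x v (fun y => constr a b y 0 i) (dotv (a i) v).
Proof.
have -> : (fun y => constr a b y 0 i) = dotv (a i) - cst (b i).
  by apply/funext => y; rewrite /constr mxE.
apply: is_derive_eq; first exact: is_deriveB (is_derive_dotv _ _ _) _.
by rewrite subr0.
Qed.

Lemma differentiable_constr i x :
  differentiable (fun y => constr a b y 0 i) x.
Proof.
have -> : (fun y => constr a b y 0 i) = dotv (a i) - cst (b i).
  by apply/funext => y; rewrite /constr mxE.
by apply: differentiableB => //; exact: differentiable_dotv.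
Qed.

Let summand lam s i : 'rV[R]_n -> R :=
  (2^-1 * s) \*: (fun y => constr a b y 0 i) ^+ 2
  - (lam 0 i) \*: (fun y => constr a b y 0 i).

Lemma penaltyE lam s : penalty lam s = \sum_(i < m) summand lam s i.
Proof.
apply/funext => x; rewrite fct_sumE; apply: eq_bigr => i _.
by rewrite /summand !fctE addrC.
Qed.

Lemma is_derive_penalty lam s x v : is_derive x v (penalty lam s)
  (\sum_(i < m) (s * constr a b x 0 i - lam 0 i) * dotv (a i) v).
Proof.
rewrite penaltyE; apply: is_derive_sum => i.
have dc := is_derive_constr i x v.
apply: is_derive_eq.
by rewrite /= expr1 /GRing.scale /=; field.
Qed.

Lemma differentiable_penalty lam s x : differentiable (penalty lam s) x.
Proof.
rewrite penaltyE; apply: differentiable_sum => i.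
have dc := differentiable_constr i x.
apply: differentiableB; apply: differentiableZ => //.
exact: differentiableX.
Qed.

Lemma dotv_delta (u : 'rV[R]_n) j : dotv u (delta_mx 0 j) = u 0 j.
Proof.
rewrite /dotv (bigD1 j) //= mxE !eqxx mulr1 big1 ?addr0 // => i ij.
by rewrite mxE eqxx (negbTE ij) mulr0.
Qed.

Lemma partial_penalty lam s j : partial j (penalty lam s) =
  fun x => \sum_(i < m) (s * constr a b x 0 i - lam 0 i) * a i 0 j.
Proof.
apply/funext => x; rewrite /partial.
have /@derive_val -> := is_derive_penalty lam s x (delta_mx 0 j).
by apply: eq_bigr => i _; rewrite dotv_delta.
Qed.

Lemma partial_penaltyE lam s j : partial j (penalty lam s) =
  \sum_(i < m) (s * a i 0 j \*: (fun y => constr a b y 0 i)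
                - cst (lam 0 i * a i 0 j)).
Proof.
rewrite partial_penalty; apply/funext => x; rewrite fct_sumE.
apply: eq_bigr => i _; rewrite !fctE /= -[_ *: _]/(_ * _); ring.
Qed.

Lemma differentiable_partial_penalty lam s j x :
  differentiable (partial j (penalty lam s)) x.
Proof.
rewrite partial_penaltyE; apply: differentiable_sum => i.
apply: differentiableB => //; apply: differentiableZ.
exact: differentiable_constr.
Qed.

Lemma partial2_penalty lam s i j : partial i (partial j (penalty lam s)) =
  cst (\sum_(k < m) s * a k 0 j * a k 0 i).
Proof.
rewrite partial_penaltyE; apply/funext => x; rewrite /partial.
apply/derive_val/is_derive_sum => k.
have dc := is_derive_constr k x (delta_mx 0 i).
by apply: is_derive_eq; rewrite subr0 dotv_delta.
Qed.

Lemma times_differentiable_penalty p lam s :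
  times_differentiable p (penalty lam s).
Proof.
case: p => [//|p]; split=> [x|j]; first exact: differentiable_penalty.
case: p => [//|p]; split=> [x|i]; first exact: differentiable_partial_penalty.
by rewrite partial2_penalty; exact: times_differentiable_cst.
Qed.

(** The second derivatives of the penalty are constant, so it drops out of differences of [p]-th
    derivatives; the same [L] serves however large [s] becomes. *)
Lemma smooth_auglag f lam s p L glow : (2 <= p)%N ->
  times_differentiable p f -> lipschitz_deriv p f L ->
  bounded_below (auglag f a b lam s) glow ->
  smooth_objective p (auglag f a b lam s) glow L.
Proof.
case: p => [//|[//|p]] _ tf lf bP; split=> // [|x y].
  exact: times_differentiableD tf (times_differentiable_penalty _ _ _).
rewrite auglagE deriv_tensorB_quadratic //.
- by move=> z; exact: differentiable_penalty.
- by move=> i z; exact: differentiable_partial_penalty.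
- by move=> i j; eexists; exact: partial2_penalty.
Qed.

(** The penalty contributes [(s c_i - lam_i) a_i] to the gradient, that is, minus the updated
    multiplier times [a_i]. Hence Step 1 already gives the KKT gradient condition for the new
    pair. *)
Lemma grad_auglag f lam s x : (forall z, differentiable f z) ->
  grad (auglag f a b lam s) x =
  grad (lagrangian f a b (lam - s *: constr a b x)) x.
Proof.
move=> df; apply/rowP => j; rewrite !mxE auglagE lagrangianE.
rewrite !partialD //; try by move=> z; exact: differentiable_penalty.
rewrite !fctE /= !partial_penalty; congr (_ + _); apply: eq_bigr => i _.
by rewrite !mxE; ring.
Qed.

(** Coordinatewise, [- l c + s c^2 / 2 = ((l - s c)^2 - l^2) / (2 s)]. *)
Lemma auglag_square f lam s x : 0 < s ->
  let mu := lam - s *: constr a b x in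
  auglag f a b lam s x = f x + dotv mu mu / (2 * s) - dotv lam lam / (2 * s).
Proof.
move=> s0 mu; rewrite /auglag -addrA; congr (_ + _).
rewrite /dotv !mulr_suml -sumrB; apply: eq_bigr => i _.
rewrite /mu !mxE; field; exact: lt0r_neq0.
Qed.

End Penalty.

(** * One run: growth of the multipliers and cost of each inner call *)

Section Run.
Variables (R : realType) (n m p : nat).
Variables (a : 'I_m -> 'rV[R]_n) (b : 'I_m -> R) (f : 'rV[R]_n -> R).
Variables (flow Lp C : R) (x0 : 'rV[R]_n) (M : method R n) (t : trace R n m).
Variables (lambda0 : 'rV[R]_m) (alpha sigma0 gamma eps : R).
Hypothesis p_ge2 : (2 <= p)%N.
Hypothesis C_gt0 : 0 < C.
Hypothesis f_smooth : times_differentiable p f.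
Hypothesis f_ge : bounded_below f flow.
Hypothesis f_lipschitz : lipschitz_deriv p f Lp.
Hypothesis M_complexity : assumptionA6 p M C.
Hypothesis M_monotone : monotone_method p M.
Hypothesis run : alm_run f a b M x0 lambda0 alpha sigma0 gamma eps t.

Let Delta := f x0 - flow.
Let A := dotv lambda0 lambda0 / sigma0.
Let E := eps `^ (- (p.+1%:R / p%:R)).
Let P k := auglag f a b (lambda t k) (sigma t k).

Let Delta_ge0 : 0 <= Delta.
Proof. by rewrite subr_ge0. Qed.

Let eps_gt0 : 0 < eps.
Proof. by have [_ _ _ /andP[]] := run_params run. Qed.

Let A_ge0 : 0 <= A.
Proof.
by have [_ s0 _ _] := run_params run; rewrite divr_ge0 ?dotvv_ge0 // ltW.
Qed.

Lemma sigma_nondecreasing k : sigma t k <= sigma t k.+1.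
Proof. by rewrite (run_sigma run); case: ifP => // _; rewrite le_max lexx orbT. Qed.

Lemma sigma_gt0 k : 0 < sigma t k.
Proof.
elim: k => [|k IH]; last exact: lt_le_trans (sigma_nondecreasing k).
by have [_ s0 _ _] := run_params run; rewrite (run_sigma0 run).
Qed.

Lemma sigma_ge k : sigma0 <= sigma t k.
Proof.
elim: k => [|k IH]; last exact: le_trans (sigma_nondecreasing k).
by rewrite (run_sigma0 run).
Qed.

Lemma auglag_x0 lam s : auglag f a b lam s x0 = f x0.
Proof.
rewrite /auglag big1 ?addr0 // => i _.
by rewrite /constr mxE (run_feasible run) mulr0 expr0n mulr0 oppr0 addr0.
Qed.

Lemma auglag_step k : P k (xs t k.+1) <= f x0.
Proof.
have [-> [+ _] _] := run_step1 run k.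
by rewrite le_min auglag_x0 => /andP[].
Qed.

(** In completed-square form, [P k (xs t k.+1) <= f x0] and [flow <= f] bound the increase of the
    squared multiplier norm over [2 * sigma t k] by [Delta]. *)
Lemma multiplier_step k :
  dotv (lambda t k.+1) (lambda t k.+1) <=
  dotv (lambda t k) (lambda t k) + 2 * sigma t k * Delta.
Proof.
have s0 := sigma_gt0 k; have := auglag_step k.
rewrite /P auglag_square // -(run_lambda run) => H.
have {H} : dotv (lambda t k.+1) (lambda t k.+1) / (2 * sigma t k)
    <= dotv (lambda t k) (lambda t k) / (2 * sigma t k) + Delta.
  have := f_ge (xs t k.+1); rewrite /Delta; lra.
rewrite -[X in _ <= _ + X](@mulfK _ (2 * sigma t k)) ?mulf_neq0 ?gt_eqF //.
by rewrite -mulrDl ler_pM2r ?invr_gt0 ?mulr_gt0 // [Delta * _]mulrC.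
Qed.

Lemma multiplier_bound k :
  dotv (lambda t k) (lambda t k) <= sigma t k * (A + 2 * Delta * k%:R).
Proof.
elim: k => [|k IH].
  have [_ s0 _ _] := run_params run.
  rewrite (run_lambda0 run) (run_sigma0 run) /A mulr0 addr0.
  by rewrite mulrC divfK ?gt_eqF.
apply: le_trans (multiplier_step k) _.
apply: (@le_trans _ _ (sigma t k * (A + 2 * Delta * k.+1%:R))).
  rewrite -natr1; nra.
apply: ler_wpM2r; last exact: sigma_nondecreasing.
by rewrite addr_ge0 // mulr_ge0 // mulr_ge0.
Qed.

(** The old [sigma t k] is kept on the right because [theta t k.+1] divides [lambda t k.+1] by
    it. *)
Lemma multiplier_bound_next k :
  dotv (lambda t k.+1) (lambda t k.+1) <= sigma t k * (A + 2 * Delta * k.+1%:R).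
Proof.
apply: le_trans (multiplier_step k) _; rewrite -natr1.
have := multiplier_bound k; nra.
Qed.

(** By the multiplier update, [c(x_{k+1}) - lambda_k / sigma_k = - lambda_{k+1} / sigma_k]. *)
Lemma thetaE k : theta t k.+1 =
  Num.max (`|lambda t k| / sigma t k) (`|lambda t k.+1| / sigma t k).
Proof.
have s0 := sigma_gt0 k; rewrite (run_theta run) normrZ gtr0_norm ?invr_gt0 //.
rewrite mulrC; congr Num.max.
have -> : constr a b (xs t k.+1) - (sigma t k)^-1 *: lambda t k
    = - ((sigma t k)^-1 *: lambda t k.+1).
  by rewrite (run_lambda run) scalerBr scalerA mulVf ?gt_eqF // scale1r opprB.
by rewrite normrN normrZ gtr0_norm ?invr_gt0 // mulrC.
Qed.

Lemma theta_ge0 k : 0 <= theta t k.+1.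
Proof. by rewrite thetaE le_max divr_ge0 // ltW // sigma_gt0. Qed.

Lemma theta_bound k :
  theta t k.+1 ^+ 2 <= (A + 2 * Delta * k.+1%:R) / sigma t k.
Proof.
have s0 := sigma_gt0 k.
have bnd (u : 'rV[R]_m) : dotv u u <= sigma t k * (A + 2 * Delta * k.+1%:R) ->
    (`|u| / sigma t k) ^+ 2 <= (A + 2 * Delta * k.+1%:R) / sigma t k.
  move=> /(le_trans (sqr_normv_le u)) H.
  rewrite expr_div_n ler_pdivrMr ?exprn_gt0 // (le_trans H) //.
  by rewrite expr2 mulrA divfK ?gt_eqF // mulrC.
rewrite thetaE maxEle; case: ifP => _; apply: bnd; first exact: multiplier_bound_next.
apply: le_trans (multiplier_bound k) _; apply: ler_wpM2l; first exact: ltW.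
by rewrite lerD2l ler_wpM2l ?mulr_ge0 // ler_nat.
Qed.

Lemma constr_le_theta k : `|constr a b (xs t k.+1)| <= 2 * theta t k.+1.
Proof.
rewrite (run_theta run); set u := _ *: _; set c := constr _ _ _.
rewrite -[c in leLHS](subrK u) (le_trans (ler_normD _ _)) //.
by rewrite mulr2n mulrDl !mul1r lerD // le_max lexx ?orbT.
Qed.

Lemma approx_KKT_of_theta k : 2 * theta t k.+1 <= eps ->
  approx_KKT f a b eps (xs t k.+1) (lambda t k.+1).
Proof.
move=> th; split; last exact: le_trans (constr_le_theta k) _.
have [-> [_ +] _] := run_step1 run k.
rewrite grad_auglag; first by have [<- _ _] := run_step1 run k; rewrite (run_lambda run).
by move: p_ge2 f_smooth; case: p => [//|q] _ [].
Qed.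

(** The square of the updated multiplier is dropped and the other one bounded by [multiplier_bound].
    This lower bound is fed to the complexity guarantee; its linear decrease in [k] yields the
    factor [k.+1] in [inner_bound]. *)
Lemma auglag_lower k :
  bounded_below (P k) (flow - (A / 2 + Delta * k%:R)).
Proof.
move=> x; have s0 := sigma_gt0 k; rewrite /P auglag_square //.
have := f_ge x; set mu := lambda t k - _ *: _.
have : 0 <= dotv mu mu / (2 * sigma t k).
  by rewrite divr_ge0 ?dotvv_ge0 // mulr_ge0 // ltW.
have : dotv (lambda t k) (lambda t k) / (2 * sigma t k) <= A / 2 + Delta * k%:R.
  rewrite ler_pdivrMr ?mulr_gt0 //; have := multiplier_bound k; nra.
lra.
Qed.

(** [Num.max Lp 1] is a positive Lipschitz constant, as the complexity guarantee demands; the final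
    [1] pays for its rounding up. *)
Let B := C * Num.max Lp 1 `^ p%:R^-1 * (Delta + A) + 1.

Let smooth_P k :
  smooth_objective p (P k) (flow - (A / 2 + Delta * k%:R)) (Num.max Lp 1).
Proof.
apply: smooth_auglag => //; last exact: auglag_lower.
move=> x y; apply: le_trans (f_lipschitz x y) _.
by rewrite ler_wpM2r ?sqrtr_ge0 // le_max lexx.
Qed.

Let E_ge1 : 1 <= E.
Proof.
have [_ _ _ /andP[e0 e1]] := run_params run.
rewrite /E powRN invf_ge1 ?powR_gt0 // -[leRHS](powRr0 eps).
have e01 : 0 < eps <= 1 by rewrite e0 ltW.
by apply: (ger_powR e01); rewrite divr_ge0.
Qed.

(** Iterate [j] of the complexity guarantee is stationary and, by monotonicity, no worse than the
    starting point, hence than [x0] and [xs t k]. It passes Step 1, so the first passing iterate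
    comes no later. *)
Lemma inner_bound k : (inner t k)%:R <= B * k.+1%:R * E.
Proof.
have L0 : 0 < Num.max Lp 1 by rewrite lt_max ltr01 orbT.
have [st [j [jle gj]]] := (run_start run k, M_complexity (start t k) (smooth_P k) L0 eps_gt0).
have [_ Px0 Pxk] := st.
have Pz i : P k (iterates M (P k) eps (start t k) i) <= P k (start t k).
  elim: i => [|i IH]; first by rewrite iterates0.
  exact: le_trans (M_monotone _ (smooth_P k) L0 eps_gt0 _) IH.
have inj : (inner t k <= j)%N.
  rewrite leqNgt; apply/negP => lt; have [_ _ /(_ _ lt)] := run_step1 run k.
  apply; split; last exact: le_trans (normv_le_enorm _) gj.
  by rewrite le_min !(le_trans (Pz j)).
have {}jle : j%:R <= C * Num.max Lp 1 `^ p%:R^-1 *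
    (P k (start t k) - (flow - (A / 2 + Delta * k%:R))) * E + 1.
  set X := C * _ * _ * _ in jle *.
  have := gt_pred_ceil X; rewrite intrB => /ltW H.
  rewrite -lerBlDr (le_trans _ H) // lerB //.
  by rewrite -[j%:R]/(j%:Z%:~R) ler_int.
rewrite (le_trans (_ : _ <= j%:R)) ?ler_nat // (le_trans jle) //.
rewrite /B; set D := C * _.
have D0 : 0 <= D by rewrite mulr_ge0 ?powR_ge0 // ltW.
apply: (@le_trans _ _ (D * (Delta + A) * k.+1%:R * E + k.+1%:R * E)); last first.
  by rewrite !mulrDl !mul1r.
apply: lerD; last by rewrite -[leLHS]mulr1 ler_pM // ler1n.
apply: ler_wpM2r; first exact: le_trans E_ge1.
(* The gap is at most [Delta + A / 2 + Delta * k], hence at most [(Delta + A) * k.+1]. *)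
rewrite -mulrA ler_wpM2l //; have : P k (start t k) <= f x0 by rewrite -(auglag_x0 (lambda t k) (sigma t k)).
rewrite -[k.+1%:R]natr1 /Delta; have := mulr_ge0 A_ge0 (ler0n R k); have := A_ge0; lra.
Qed.

Let B_ge0 : 0 <= B.
Proof.
apply: addr_ge0 => //; apply: mulr_ge0; last exact: addr_ge0.
by rewrite mulr_ge0 ?powR_ge0 // ltW.
Qed.

(** At most [N] calls are made, of at most [B * N * E] iterations each. *)
Lemma KKT_within_theta N k : (k < N)%N -> 2 * theta t k.+1 <= eps ->
  KKT_within f a b eps t (B * N%:R ^+ 2 * E).
Proof.
move=> kN th; exists k; split; first exact: approx_KKT_of_theta.
rewrite natr_sum; apply: (@le_trans _ _ (\sum_(i < k.+1) B * N%:R * E)).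
  apply: ler_sum => i _; apply: le_trans (inner_bound i) _.
  rewrite ler_wpM2r ?(le_trans _ E_ge1) // ler_wpM2l ?B_ge0 // ler_nat.
  exact: leq_trans (ltn_ord i) kN.
rewrite sumr_const card_ord -[leLHS]mulr_natr expr2.
rewrite [leRHS](_ : _ = B * N%:R * E * N%:R); last by ring.
rewrite ler_wpM2l ?ler_nat // mulr_ge0 ?(le_trans _ E_ge1) //.
exact: mulr_ge0.
Qed.

End Run.

(** * Number of outer iterations until theta is small, for abstract sequences *)

Lemma le_add1_of_sqr (R : realDomainType) (x v : R) : x ^+ 2 <= v -> x <= v + 1.
Proof. by nra. Qed.

Lemma exists_nat_gt (R : realType) (x : R) : 0 <= x ->
  exists2 k : nat, x < k%:R & k%:R <= x + 1.
Proof.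
move=> /truncn_itv/andP[xl _]; exists (Num.truncn x).+1; first exact: truncnS_gt.
by rewrite -natr1 lerD2r.
Qed.

Section OuterIterations.
Variables (R : realType) (alpha gamma sigma0 D : R).
Hypothesis alpha_gt1 : 1 < alpha.
Hypothesis gamma01 : 0 < gamma < 1.
Hypothesis sigma0_gt0 : 0 < sigma0.
Hypothesis D_ge0 : 0 <= D.

(* For a run of the algorithm, [D] is [|lambda0|^2 / sigma0 + 2 Delta]. *)
Definition outer_run (sigma theta : nat -> R) :=
  [/\ forall k, sigma0 <= sigma k,
      forall k, 0 <= theta k.+1,
      forall k, theta k.+1 ^+ 2 <= D * k.+1%:R / sigma k
    & forall k, (0 < k)%N ->
        theta k.+1 <= gamma * theta k \/ k.+1%:R `^ alpha <= sigma k.+1].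

(** Either one of the [j] steps jumps or all of them contract. [K] is positive because the update at
    [k = 0] guarantees neither alternative. *)
Lemma geometric_or_jump (sigma theta : nat -> R) K j :
  outer_run sigma theta -> (0 < K)%N ->
  (exists2 k, (K <= k < K + j)%N & k.+1%:R `^ alpha <= sigma k.+1) \/
  theta (K + j)%N <= gamma ^+ j * theta K.
Proof.
move=> [_ _ _ step] K0; elim: j => [|j [[k /andP[Kk kj] sk]|IH]].
- by right; rewrite addn0 expr0 mul1r.
- by left; exists k => //; rewrite Kk addnS ltnS ltnW.
have [H|H] := step (K + j)%N (ltn_addr _ K0); last first.
  by left; exists (K + j)%N => //; rewrite leq_addr addnS /=.
right; have /andP[g0 _] := gamma01.
by rewrite addnS (le_trans H) // exprS -mulrA ler_wpM2l // ltW.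
Qed.

Lemma theta_sqr_sigma0 (sigma theta : nat -> R) k : outer_run sigma theta ->
  theta k.+1 ^+ 2 <= D * k.+1%:R / sigma0.
Proof.
move=> [Hs _ Hq _]; apply: le_trans (Hq k) _.
apply: ler_wpM2l; first exact: mulr_ge0.
by rewrite lef_pV2 ?posrE // (lt_le_trans sigma0_gt0).
Qed.

(** The logarithm is [alpha * (ln T - T / s)], and [ln u <= u - 1] at [u = T / s] bounds it by
    [alpha * ln s]. Over positive reals, [s] is the maximizer. *)
Lemma powR_geometric_bounded :
  exists G : R, forall T : nat, (0 < T)%N -> T%:R `^ alpha * gamma ^+ T <= G.
Proof.
have /andP[g0 g1] := gamma01.
have lg : ln gamma < 0 by rewrite ln_lt0 // g0.
pose s := alpha / - ln gamma.
have a0 : 0 < alpha by apply: lt_trans alpha_gt1.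
have s0 : 0 < s by rewrite divr_gt0 // oppr_gt0.
exists (expR (alpha * ln s)) => T T0.
have TR : 0 < T%:R :> R by rewrite ltr0n.
rewrite -ler_ln ?posrE ?expR_gt0 ?mulr_gt0 ?powR_gt0 ?exprn_gt0 //.
rewrite expRK lnM ?posrE ?powR_gt0 ?exprn_gt0 // ln_powR lnXn // -[ln gamma *+ _]mulr_natr.
have : ln (T%:R / s) <= T%:R / s - 1.
  rewrite -[X in ln X](subrK 1) addrC le_ln1Dx // ltrBrDr addNr.
  by rewrite divr_gt0.
rewrite ln_div ?posrE // => H.
have -> : ln gamma * T%:R = - (alpha * (T%:R / s)).
  by rewrite /s; field; rewrite (gt_eqF a0) (lt_eqF lg).
by rewrite -mulrBr ler_pM2l //; lra.
Qed.

Lemma outer_iterations_bounded (smax : R) :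
  exists c : R, \forall eps \near 0^'+, forall sigma theta : nat -> R,
    outer_run sigma theta -> (forall k, sigma k <= smax) ->
    exists N k, [/\ (k < N)%N, 2 * theta k.+1 <= eps & N%:R <= c * `|ln eps|].
Proof.
have /andP[g0 g1] := gamma01.
(* For [k >= K] a jump would give [sigma >= (k+1)^alpha >= k+1 > smax], so only contractions
   remain. *)
have [K K_gt0 smaxK] : exists2 K, (0 < K)%N & smax < K%:R.
  by exists (Num.truncn smax).+1 => //; exact: truncnS_gt.
(* [W] bounds [2 * theta K], through [x <= x^2 + 1]. *)
have [W WE] : exists W, W = 2 * (D * K%:R / sigma0 + 1) by eexists.
have [g gE] : exists g, g = - ln gamma by eexists.
have gp : 0 < g by rewrite gE oppr_gt0 ln_lt0 // g0.
have V0 : 0 <= D * K%:R / sigma0 by rewrite divr_ge0 ?mulr_ge0 // ltW.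
have W1 : 1 <= W by rewrite WE; lra.
have W0 : 0 < W by apply: lt_le_trans W1.
(* With [N = K + j], the terms account for [K], for [j] and for rounding [j]; each is absorbed using
   [|ln eps| >= 1], valid for [eps <= exp(-1)]. *)
exists (K%:R + (ln W + 1) / g + 1); near=> eps => sigma theta run Hb.
have eps0 : 0 < eps by near: eps; exact: nbhs_right_gt.
have leps : 1 <= - ln eps.
  rewrite lerNr -[leRHS]expRK ler_ln ?posrE ?expR_gt0 //.
  by near: eps; apply: nbhs_right_le; exact: expR_gt0.
have lnW : 0 <= ln W by exact: ln_ge0.
(* This [j] makes [gamma ^+ j * W] smaller than [eps]. *)
have [|j jgt jle] := @exists_nat_gt R ((ln W - ln eps) / g).
  by rewrite divr_ge0 ?(ltW gp) // addr_ge0 // (le_trans ler01).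
have [[k /andP[Kk _] sk]|th] := geometric_or_jump j run K_gt0.
- exfalso; have := le_trans sk (Hb k.+1); apply/negP; rewrite -ltNge.
  apply: lt_le_trans (le1r_powR _ (ltW alpha_gt1)); last by rewrite ler1n.
  by rewrite (lt_le_trans smaxK) // ler_nat ltnW.
exists (K + j)%N, (K + j).-1; split; first by rewrite prednK // addn_gt0 K_gt0.
- have -> : (K + j).-1.+1 = (K + j)%N by rewrite prednK // addn_gt0 K_gt0.
  have thK : 2 * theta K <= W.
    rewrite WE ler_pM2l //.
    have H := theta_sqr_sigma0 K.-1 run.
    by rewrite prednK // in H; exact: le_add1_of_sqr H.
  have gj : 0 <= gamma ^+ j by rewrite exprn_ge0 // ltW.
  apply: le_trans (_ : gamma ^+ j * W <= _).
    by rewrite (le_trans (ler_wpM2l _ th)) // mulrCA ler_wpM2l.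
  have gjp : 0 < gamma ^+ j by rewrite exprn_gt0.
  have gWp : 0 < gamma ^+ j * W by rewrite mulr_gt0.
  rewrite -ler_ln ?posrE // lnM ?posrE //.
  rewrite lnXn // -[ln gamma *+ _]mulr_natr.
  move: jgt; rewrite ltr_pdivrMr // gE mulrN ltrBlDr [- _ + _]addrC ltrBrDr.
  by rewrite [_%:R * _]mulrC addrC => /ltW.
rewrite ler0_norm; last by rewrite -oppr_ge0 (le_trans ler01).
rewrite natrD -addrA [(K%:R + _) * _]mulrDl lerD //.
  by rewrite -[leLHS]mulr1 ler_wpM2l.
rewrite (le_trans jle) // [(_ + 1) * - _]mulrDl mul1r lerD // mulrAC ler_pM2r ?invr_gt0 //.
rewrite mulrDl mul1r lerD2r.
by rewrite -[leLHS]mulr1 ler_wpM2l.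
Unshelve. all: end_near.
Qed.

Lemma outer_iterations_unbounded :
  exists c : R, forall (eps : R) (sigma theta : nat -> R), 0 < eps < 1 ->
    outer_run sigma theta ->
    exists N k, [/\ (k < N)%N, 2 * theta k.+1 <= eps
      & N%:R <= c * eps `^ (- (2 / (alpha - 1)))].
Proof.
have /andP[g0 g1] := gamma01.
have [G HG] := powR_geometric_bounded.
pose be := alpha - 1; have be0 : 0 < be by rewrite subr_gt0.
have G0 : 0 <= G.
  by apply: le_trans (HG 1%N isT); rewrite mulr_ge0 ?powR_ge0 // exprn_ge0 // ltW.
have DG0 : 0 <= D / sigma0 * G by rewrite mulr_ge0 // divr_ge0 // ltW.
(* [V] dominates the constants of both cases: [2 * D] after a jump, [D / sigma0 * G] after
   contractions. *)
have [V [V1 V2D VDG]] :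
    exists V, [/\ 1 <= V, 2 * D <= V & D / sigma0 * G <= V].
  exists (2 * D + D / sigma0 * G + 1); have D2 : 0 <= 2 * D by rewrite mulr_ge0.
  split; first by rewrite lerDr addr_ge0.
    by rewrite -addrA lerDl addr_ge0.
  by rewrite addrAC lerDr addr_ge0.
have V4 : 1 <= 4 * V by rewrite -[leLHS]mulr1 ler_pM // ler1n.
have V4_ge0 : 0 <= 4 * V by apply: le_trans V4.
(* The factor 6 comes from [N = 2T + 2 <= 2X + 4 <= 6X], with [T <= X + 1] and [X >= 1] below. *)
exists (6 * (4 * V) `^ be^-1) => eps sigma theta /andP[e0 e1] run.
have [Hs Ht Hq _] := run.
set r := eps `^ _.
(* [X] solves [X^be = 4 V / eps^2], so [T > X] turns [theta^2 <= V / T^be] into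
   [4 theta^2 <= eps^2]. *)
pose X := (4 * V) `^ be^-1 * r.
have X0 : 0 <= X by rewrite mulr_ge0 ?powR_ge0.
have X1 : 1 <= X.
  rewrite -[leLHS]mulr1 ler_pM //.
    have P1 : 1 = 1 `^ be^-1 :> R by rewrite powR1.
    by rewrite [leLHS]P1 ge0_ler_powR ?nnegrE ?invr_ge0 ?(ltW be0).
  rewrite /r powRN invf_ge1 ?powR_gt0 // -[leRHS](powRr0 eps).
  have e01 : 0 < eps <= 1 by rewrite e0 ltW.
  by apply: (ger_powR e01); rewrite divr_ge0 // ltW.
have Xbe : X `^ be = 4 * V / eps ^+ 2.
  rewrite /X powRM ?powR_ge0 // -powRrM mulVf ?gt_eqF // powRr1 //.
  rewrite /r -powRrM mulNr divfK ?gt_eqF // powRN.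
  by rewrite powR_mulrn // ltW.
have [T XT TX] := exists_nat_gt X0.
have T0 : 0 < T%:R :> R by apply: le_lt_trans XT.
have T_gt0 : (0 < T)%N by rewrite -(ltr0n R).
(* Inside the window, either the penalty jumps to at least [T ^ alpha], or
   [theta] contracts [T] times. *)
suff [k kT thk] : exists2 k, (k < 2 * T + 2)%N & theta k.+1 ^+ 2 <= V / T%:R `^ be.
  exists (2 * T + 2)%N, k; split=> //; last first.
    by rewrite natrD natrM -mulrA -/X; lra.
  rewrite -ler_sqr ?nnegrE ?mulr_ge0 ?(ltW e0) //.
  have Tbe : 4 * V / eps ^+ 2 <= T%:R `^ be.
    by rewrite -Xbe ge0_ler_powR ?nnegrE // ltW.
  have e2 : 0 < eps ^+ 2 by rewrite exprn_gt0.
  have Tp : 0 < T%:R `^ be by rewrite powR_gt0.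
  rewrite exprMn; move: thk Tbe; rewrite ler_pdivlMr // ler_pdivrMr //.
  set z := theta _ ^+ 2; set q := T%:R `^ be in Tp *; set w := eps ^+ 2 => H1 H2.
  rewrite -(ler_pM2r Tp); lra.
have alE (y : R) : 0 < y -> y `^ alpha = y * y `^ be.
  by move=> y0; rewrite mulr_powRB1 ?(ltW y0) // (lt_trans _ alpha_gt1).
have [[k /andP[Tk kT] sk]|th] :=
    geometric_or_jump T run T_gt0.
  (* After the jump, [theta_{k+2}^2 <= D (k+2) / (k+1)^alpha <= 2 D / (k+1)^be], and [k >= T]. *)
  exists k.+1; first by rewrite mul2n -addnn addn2 !ltnS ltnW.
  have y0 : 0 < k.+1%:R :> R by [].
  have Ty : T%:R `^ be <= k.+1%:R `^ be.
    by rewrite ge0_ler_powR ?nnegrE ?ler_nat ?(ltW be0) // ltnW.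
  have Tp : 0 < T%:R `^ be by rewrite powR_gt0.
  have yp : 0 < k.+1%:R `^ be by rewrite powR_gt0.
  apply: le_trans (Hq k.+1) _.
  apply: (@le_trans _ _ (D * k.+2%:R / (k.+1%:R `^ alpha))).
    rewrite ler_wpM2l ?mulr_ge0 // lef_pV2 ?posrE ?powR_gt0 //.
    by rewrite (lt_le_trans sigma0_gt0).
  apply: (@le_trans _ _ (D * (2 * k.+1%:R) / (k.+1%:R `^ alpha))).
    rewrite ler_wpM2r ?invr_ge0 ?powR_ge0 // ler_wpM2l // -natrM ler_nat.
    by rewrite mul2n doubleS !ltnS -addnn leq_addr.
  have -> : D * (2 * k.+1%:R) / k.+1%:R `^ alpha = 2 * D / k.+1%:R `^ be.
    by rewrite alE //; field; rewrite !gt_eqF.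
  apply: (@le_trans _ _ (2 * D / T%:R `^ be)).
    by rewrite ler_wpM2l ?mulr_ge0 // lef_pV2 ?posrE.
  by rewrite ler_wpM2r ?invr_ge0 ?powR_ge0.
exists (T + T).-1.
  by rewrite (leq_ltn_trans (leq_pred _)) // mul2n -addnn addn2 ltnS leqnSn.
have TT : (T + T).-1.+1 = (T + T)%N by rewrite prednK // addn_gt0 T_gt0.
rewrite TT.
have gT : 0 <= gamma ^+ T <= 1 by rewrite exprn_ge0 ?exprn_ile1 // ltW.
have thT := theta_sqr_sigma0 T.-1 run.
have thT0 := Ht T.-1.
have th2 := Ht (T + T).-1.
rewrite prednK // in thT thT0; rewrite TT in th2.
(* Squaring yields [gamma ^+ T] twice: one factor is bounded by 1, the other is matched with
   [T^alpha] through [G]. *)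
apply: (@le_trans _ _ (gamma ^+ T * theta T ^+ 2)).
  move: gT => /andP[? ?].
  apply: (@le_trans _ _ ((gamma ^+ T * theta T) ^+ 2)).
    by rewrite ler_sqr ?nnegrE ?mulr_ge0.
  rewrite exprMn ler_wpM2r ?sqr_ge0 // expr2; nra.
have /andP[gT0 _] := gT.
apply: le_trans (ler_wpM2l gT0 thT) _.
have Tp : 0 < T%:R `^ be by rewrite powR_gt0.
rewrite ler_pdivlMr //.
have := HG T T_gt0; rewrite alE // => H.
have -> : gamma ^+ T * (D * T%:R / sigma0) * T%:R `^ be
    = D / sigma0 * (T%:R * T%:R `^ be * gamma ^+ T) by ring.
have Ds : 0 <= D / sigma0 by rewrite divr_ge0 // ltW.
exact: le_trans (ler_wpM2l Ds H) VDG.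
Qed.

End OuterIterations.

(** * Assembly of the two complexity bounds *)

Lemma KKT_withinW (R : realType) (n m : nat) (f : 'rV[R]_n -> R)
    (a : 'I_m -> 'rV[R]_n) (b : 'I_m -> R) (eps : R) (t : trace R n m) (B1 B2 : R) :
  B1 <= B2 -> KKT_within f a b eps t B1 -> KKT_within f a b eps t B2.
Proof. by move=> B12 [k [kkt le]]; exists k; split=> //; exact: le_trans B12. Qed.

(** The absolute value makes the constant nonnegative for any real [Delta], which the theorem fixes
    before [f]. *)
Lemma alm_outer_run (R : realType) (n m : nat) (a : 'I_m -> 'rV[R]_n)
    (b : 'I_m -> R) (f : 'rV[R]_n -> R) (flow Delta : R) (x0 : 'rV[R]_n)
    (M : method R n) (t : trace R n m) (lambda0 : 'rV[R]_m)
    (alpha sigma0 gamma eps : R) :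
  bounded_below f flow -> f x0 - flow = Delta ->
  alm_run f a b M x0 lambda0 alpha sigma0 gamma eps t ->
  outer_run alpha gamma sigma0 (dotv lambda0 lambda0 / sigma0 + 2 * `|Delta|)
    (sigma t) (theta t).
Proof.
move=> fl fD run; have [_ s0 _ _] := run_params run; split=> [k|k|k|k k0].
- exact: sigma_ge run k.
- exact: theta_ge0 run k.
- apply: le_trans (theta_bound fl run k) _; rewrite fD.
  rewrite ler_wpM2r ?invr_ge0 ?(ltW (sigma_gt0 run k)) // [leRHS]mulrDl.
  apply: lerD; last by rewrite ler_wpM2r // ler_wpM2l // ler_norm.
  by rewrite -[leLHS]mulr1 ler_wpM2l ?ler1n // divr_ge0 ?dotvv_ge0 // ltW.
- rewrite (run_sigma run) (gtn_eqF k0) /=; case: ifP => th; first by left.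
  by right; rewrite le_max lexx.
Qed.

Theorem theorem3p6 (R : realType) (n m p : nat)
    (a : 'I_m -> 'rV[R]_n) (b : 'I_m -> R) (Lp Delta C : R)
    (lambda0 : 'rV[R]_m) (sigma0 alpha gamma : R) :
  (2 <= p)%N -> 0 < C -> 1 < alpha -> 0 < sigma0 -> 0 < gamma < 1 ->
  (* (a) *)
  (forall sigma_max : R,
    exists K : R, \forall eps \near 0^'+,
      forall (f : 'rV[R]_n -> R) (flow : R) (x0 : 'rV[R]_n)
             (M : method R n) (t : trace R n m),
        times_differentiable p f -> assumptionA1 f flow ->
        lipschitz_deriv p f Lp -> f x0 - flow = Delta ->
        assumptionA6 p M C -> monotone_method p M ->
        alm_run f a b M x0 lambda0 alpha sigma0 gamma eps t ->
        (forall k, sigma t k <= sigma_max) ->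
        KKT_within f a b eps t
          (K * (`|ln eps| ^+ 2 * eps `^ (- (p.+1%:R / p%:R))))) /\
  (* (b) *)
  (exists K : R, \forall eps \near 0^'+,
      forall (f : 'rV[R]_n -> R) (flow : R) (x0 : 'rV[R]_n)
             (M : method R n) (t : trace R n m),
        times_differentiable p f -> assumptionA1 f flow ->
        lipschitz_deriv p f Lp -> f x0 - flow = Delta ->
        assumptionA6 p M C -> monotone_method p M ->
        alm_run f a b M x0 lambda0 alpha sigma0 gamma eps t ->
        sigma t @ \oo --> +oo ->
        KKT_within f a b eps t
          (K * eps `^ (- (4 / (alpha - 1) + p.+1%:R / p%:R)))).
Proof.
move=> p2 C0 al s0 ga.
pose A := dotv lambda0 lambda0 / sigma0.
(* The constant of a single run with [Delta] replaced by its absolute value: it depends on the data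
   only, so [K] can be chosen before [f], [M] and the run. *)
pose B := C * Num.max Lp 1 `^ p%:R^-1 * (`|Delta| + A) + 1.
have A0 : 0 <= A by rewrite divr_ge0 ?dotvv_ge0 // ltW.
have B0 : 0 <= B by rewrite addr_ge0 // !mulr_ge0 ?addr_ge0 ?powR_ge0 // ltW.
have D0 : 0 <= A + 2 * `|Delta| by rewrite addr_ge0 // mulr_ge0.
(* Common end of both parts: a bound [N1] on outer iterations gives one on inner iterations,
   quadratic in [N1]. *)
have within (eps N1 : R) f flow x0 (M : method R n) (t : trace R n m) N k :
    times_differentiable p f -> assumptionA1 f flow ->
    lipschitz_deriv p f Lp -> f x0 - flow = Delta ->
    assumptionA6 p M C -> monotone_method p M ->
    alm_run f a b M x0 lambda0 alpha sigma0 gamma eps t ->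
    (k < N)%N -> 2 * theta t k.+1 <= eps -> N%:R <= N1 ->
    KKT_within f a b eps t (B * N1 ^+ 2 * eps `^ (- (p.+1%:R / p%:R))).
  move=> tf [_ _ fl _] lf fD MC Mm run kN th NN1.
  have DE : `|Delta| = f x0 - flow by rewrite ger0_norm -fD // subr_ge0.
  apply: KKT_withinW (KKT_within_theta p2 C0 tf fl lf MC Mm run kN th).
  rewrite -DE -/A -/B ler_wpM2r ?powR_ge0 // ler_wpM2l //.
  by rewrite lerXn2r // nnegrE // (le_trans _ NN1).
split=> [smax|].
  have [c Hc] := outer_iterations_bounded al ga s0 D0 smax.
  exists (B * c ^+ 2).
  apply: filterS Hc => eps Hc f flow x0 M t tf A1 lf fD MC Mm run sb.
  have [||N [k [kN th NN1]]] := Hc (sigma t) (theta t).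
  - by case: A1 => _ _ fl _; exact: alm_outer_run fl fD run.
  - exact: sb.
  have := within _ _ _ _ _ _ _ _ _ tf A1 lf fD MC Mm run kN th NN1.
  by rewrite exprMn !mulrA.
have [c Hc] := outer_iterations_unbounded al ga s0 D0.
exists (B * c ^+ 2); apply: nearW => eps f flow x0 M t tf A1 lf fD MC Mm run _.
have [_ _ _ e01] := run_params run; have /andP[e0 e1] := e01.
have [|N [k [kN th NN1]]] := Hc eps (sigma t) (theta t) e01.
  by case: A1 => _ _ fl _; exact: alm_outer_run fl fD run.
have := within _ _ _ _ _ _ _ _ _ tf A1 lf fD MC Mm run kN th NN1.
set r := eps `^ (- (2 / (alpha - 1))).
(* Squaring the outer count doubles the exponent [2 / (alpha - 1)]. *)
have r2 : r ^+ 2 = eps `^ (- (4 / (alpha - 1))).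
  rewrite -(powR_mulrn 2 (powR_ge0 eps _)) -powRrM; congr (_ `^ _); ring.
rewrite opprD powRD ?(gt_eqF e0) ?implybT // -r2.
by rewrite exprMn !mulrA.
Qed.
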